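(* Let $\mathcal{E}\subsetneq E$ be a non-cut set outage for the connected power network $G=(V,E,\bm{b})$. Let $E=E_1\cup\dots\cup E_k$ be the block decomposition of the edge set, and put $\mathcal{E}_j=\mathcal{E}\cap E_j$ and $\mathcal{E}_{-j}=E_j\setminus\mathcal{E}_j$ for $j=1,\dots,k$, with the lines of $\mathcal{E}$ and of $-\mathcal{E}=E\setminus\mathcal{E}$ ordered by blocks. Then the rectangular $|-\mathcal{E}|\times|\mathcal{E}|$ GLODF matrix $K^{\mathcal{E}}$ has a block-diagonal structure, i.e., $$K^{\mathcal{E}}=\begin{bmatrix}K^{\mathcal{E}}_1&0&\dots&0\\0&K^{\mathcal{E}}_2&\dots&0\\\vdots&\vdots&\ddots&\vdots\\0&0&\dots&K^{\mathcal{E}}_k\end{bmatrix},$$ where each $K^{\mathcal{E}}_j$ is $|\mathcal{E}_{-j}|\times|\mathcal{E}_j|$ and involves lines only in block $E_j$ of $G$, given by $$K^{\mathcal{E}}_j=B_{-j}C_{-j}^TL^\dag C_j\left(I-B_jC_j^TL^\dag C_j\right)^{-1},\qquad j=1,\dots,k.$$ Equivalently, $$K^{\mathcal{E}}_j=D_{-j}(I-D_j)^{-1}=K_j\left(I-\mathrm{diag}(D_j)\right)\left(I-D_j\right)^{-1},\qquad j=1,\dots,k,$$ where $D_{-j}=B_{-j}C_{-j}^TL^\dag C_j$, $D_j=B_jC_j^TL^\dag C_j$ and $K_j=D_{-j}(I-\mathrm{diag}(D_j))^{-1}$. Furthermore, for every $\ell\in-\mathcal{E}$ and $\hat\ell\in\mathcal{E}$,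 if $\ell$ and $\hat\ell$ are in different blocks of $G$, then $K^{\mathcal{E}}_{\ell\hat\ell}=0$.
   Context: A power network $G=(V,E,\bm{b})$ is a finite simple undirected graph with $n=|V|$ vertices and $m=|E|$ edges (called lines), where each line $\ell=(i,j)$ has a susceptance $b_\ell>0$ and an arbitrary fixed orientation. $B=\mathrm{diag}(b_1,\dots,b_m)$; $C\in\{-1,0,1\}^{n\times m}$ is the vertex-edge incidence matrix ($C_{i\ell}=1$ if $i$ is the source of $\ell$, $-1$ if $i$ is the target of $\ell$, $0$ otherwise); $L=CBC^T$ is the weighted Laplacian and $L^\dag$ its Moore-Penrose pseudo-inverse. For balanced injections $\bm{p}$ (entries summing to zero) the DC line flows are $\bm{f}=BC^TL^\dag\bm{p}$. The PTDF matrix is the $m\times m$ matrix $D=BC^TL^\dag C$. A set $\mathcal{E}\subsetneq E$ is a non-cut set if $(V,E\setminus\mathcal{E})$ is still connected. Put $-\mathcal{E}=E\setminus\mathcal{E}$. $D_{-\mathcal{E}\mathcal{E}}$ and $D_{\mathcal{E}\mathcal{E}}$ are the submatrices of $D$ with columns indexed by $\mathcal{E}$ and rows indexed by $-\mathcal{E}$ and $\mathcal{E}$, respectively. For a non-cut set $\mathcal{E}$ the matrix $I-D_{\mathcal{E}\mathcal{E}}$ is invertible, and the generalized line outage distribution factor (GLODF) matrix is $$K^{\mathcal{E}}=(K^{\mathcal{E}}_{\ell\hat\ell},\ \ell\in-\mathcal{E},\ \hat\ell\in\mathcal{E})=D_{-\mathcal{E}\mathcal{E}}\,(I-D_{\mathcal{E}\mathcal{E}})^{-1}.$$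 It describes the flow changes on surviving lines when all lines of $\mathcal{E}$ are removed simultaneously with unchanged injections: $\Delta\bm{f}_{-\mathcal{E}}=K^{\mathcal{E}}\bm{f}_{\mathcal{E}}$, where $\bm{f}_{\mathcal{E}}$ are the pre-outage flows on $\mathcal{E}$. For a square matrix $M$, $\mathrm{diag}(M)$ is the diagonal matrix with the same diagonal entries as $M$. Blocks: two edges are equivalent if they are equal or there is a simple cycle containing both; the equivalence classes $E_1,\dots,E_k$ form the block decomposition of the edge set $E$. $B_j$, $B_{-j}$ denote the diagonal submatrices of $B$ for the lines in $\mathcal{E}_j$, $\mathcal{E}_{-j}$, and $C_j$, $C_{-j}$ the submatrices of $C$ consisting of the columns for the lines in $\mathcal{E}_j$, $\mathcal{E}_{-j}$. Some of the sets $\mathcal{E}_j$, $\mathcal{E}_{-j}$ may be empty, in which case the corresponding blocks have zero columns or rows. *)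

(* Defs.v *)
From mathcomp Require Import all_boot all_order all_algebra.

Set Implicit Arguments.
Unset Strict Implicit.
Unset Printing Implicit Defensive.

Import Order.TTheory GRing.Theory Num.Theory.

Local Open Scope ring_scope.

Section PseudoInverse.

Variable R : realFieldType.

(* The Penrose conditions over a real field, where the adjoint is the
   transpose; they determine X ([penrose_uniq]). *)
Definition penrose m n (A : 'M[R]_(m, n)) (X : 'M[R]_(n, m)) : bool :=
  [&& A *m X *m A == A, X *m A *m X == X,
      (A *m X)^T == A *m X & (X *m A)^T == X *m A].

Lemma row_self_eq0 n (w : 'rV[R]_n) : w *m w^T = 0 -> w = 0.
Proof.
move=> /matrixP /(_ 0 0); rewrite !mxE => w0; apply/rowP => j; rewrite mxE.
have ge0 i : true -> 0 <= w 0 i * w^T i 0 by rewrite mxE -expr2 sqr_ge0.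
move: w0 => /eqP; rewrite psumr_eq0 // => /allP /(_ j).
by rewrite mem_index_enum /= mxE mulf_eq0 orbb => /(_ isT) /eqP.
Qed.

Lemma gram_unit r n (H : 'M[R]_(r, n)) : row_free H -> H *m H^T \in unitmx.
Proof.
move=> freeH; rewrite -row_free_unit -kermx_eq0; apply/eqP/row_matrixP => i.
have := row_sub i (kermx (H *m H^T)); rewrite row0.
set v := row i _ => /sub_kermxP; rewrite mulmxA => vH0.
have /row_self_eq0 vH : (v *m H) *m (v *m H)^T = 0.
  by rewrite trmx_mul mulmxA vH0 mul0mx.
by apply: (row_free_inj freeH); rewrite vH mul0mx.
Qed.

Lemma penrose_exists m n (A : 'M[R]_(m, n)) : exists X, penrose A X.
Proof.
have uH := gram_unit (row_base_free A).
have uF : (col_base A)^T *m col_base A \in unitmx.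
  rewrite -[X in _ *m X]trmxK; apply: gram_unit.
  by rewrite -row_leq_rank mxrank_tr; have /eqP-> := col_base_full A.
move: (mulmx_base A) uH uF.
move: (\rank A) (col_base A) (row_base A) => r F H defA uH uF.
pose iH := invmx (H *m H^T); pose iF := invmx (F^T *m F).
pose X := H^T *m iH *m iF *m F^T.
have AX : A *m X = F *m iF *m F^T.
  by rewrite -defA /X !mulmxA -(mulmxA F H) mulmxK.
have XA : X *m A = H^T *m iH *m H.
  by rewrite -defA /X !mulmxA -(mulmxA _ F^T F) mulmxKV.
have tiH : iH^T = iH by rewrite /iH trmx_inv trmx_mul trmxK.
have tiF : iF^T = iF by rewrite /iF trmx_inv trmx_mul trmxK.
exists X; apply/and4P; split; apply/eqP.
- by rewrite AX -defA !mulmxA -(mulmxA _ F^T F) mulmxKV.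
- by rewrite XA /X !mulmxA -(mulmxA _ H H^T) mulmxKV.
- by rewrite AX !trmx_mul tiF trmxK !mulmxA.
- by rewrite XA !trmx_mul tiH trmxK !mulmxA.
Qed.

Definition mpinv m n (A : 'M[R]_(m, n)) : 'M[R]_(n, m) :=
  xchoose (penrose_exists A).

Lemma mpinvP m n (A : 'M[R]_(m, n)) : penrose A (mpinv A).
Proof. exact: xchooseP. Qed.

Lemma penrose_uniq m n (A : 'M[R]_(m, n)) X Y :
  penrose A X -> penrose A Y -> X = Y.
Proof.
case/and4P => /eqP X1 /eqP X2 /eqP X3 /eqP X4.
case/and4P => /eqP Y1 /eqP Y2 /eqP Y3 /eqP Y4.
have AXY : A *m X = A *m Y.
  by rewrite -X3 -{1}Y1 -(mulmxA (A *m Y)) trmx_mul X3 Y3 mulmxA X1.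
have XYA : X *m A = Y *m A.
  by rewrite -X4 -{1}Y1 -mulmxA mulmxA trmx_mul X4 mulmxA Y4 -!mulmxA (mulmxA A) X1.
by rewrite -X2 -mulmxA AXY mulmxA XYA.
Qed.

Lemma penroseE m n (A : 'M[R]_(m, n)) X : penrose A X <-> X = mpinv A.
Proof.
by split=> [AX|->]; [apply: penrose_uniq AX (mpinvP A) | apply: mpinvP].
Qed.

End PseudoInverse.

(* Vertices are 'I_n and lines are 'I_m; [simple] says that a line is
   determined by its unordered pair of endpoints. *)
Record network (R : realFieldType) (n m : nat) := Network {
  src : 'I_m -> 'I_n;
  tgt : 'I_m -> 'I_n;
  susc : 'I_m -> R;
  loopless : forall l, src l != tgt l;
  simple : injective (fun l => [set src l; tgt l]);
  susc_gt0 : forall l, 0 < susc l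
}.

Section Network.

Variables (R : realFieldType) (n m : nat) (G : network R n m).

Definition ends (l : 'I_m) : {set 'I_n} := [set src G l; tgt G l].

Definition adj (S : {set 'I_m}) : rel 'I_n :=
  fun u v => [exists l in S, ends l == [set u; v]].

Definition connected (S : {set 'I_m}) : bool :=
  [forall u, forall v, connect (adj S) u v].

Definition simple_cycle (c : seq 'I_n) : bool :=
  [&& (2 < size c)%N, cycle (adj [set: 'I_m]) c & uniq c].

Definition on_cycle (l : 'I_m) (c : seq 'I_n) : bool :=
  has (fun v => ends l == [set v; next c v]) c.

(* A simple cycle has at most [n] vertices; the bound only serves to make the
   quantifier finite, see [same_blockP]. *)
Definition same_block : rel 'I_m := fun l l' =>
  (l == l') ||
  [exists k : 'I_n.+1, exists c : k.-tuple 'I_n,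
     [&& simple_cycle c, on_cycle l c & on_cycle l' c]].

Lemma same_blockP l l' :
  reflect (l = l' \/
           exists c, [/\ simple_cycle c, on_cycle l c & on_cycle l' c])
          (same_block l l').
Proof.
apply: (iffP orP) => [[/eqP->|/existsP[k /existsP[c /and3P[? ? ?]]]]|].
- by left.
- by right; exists c.
case=> [->|[c [cyc lc l'c]]]; [by left | right].
have sz : (size c < n.+1)%N.
  have /and3P[_ _ /card_uniqP <-] := cyc.
  by rewrite ltnS -[X in (_ <= X)%N](card_ord n) max_card.
apply/existsP; exists (Ordinal sz); apply/existsP; exists (in_tuple c).
exact/and3P.
Qed.

Definition blocks : {set {set 'I_m}} :=
  equivalence_partition same_block [set: 'I_m].

Definition susc_mx : 'M[R]_m := diag_mx (\row_l susc G l).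

Definition incidence : 'M[R]_(n, m) :=
  \matrix_(i, l) (if i == src G l then 1 else if i == tgt G l then -1 else 0).

Definition laplacian : 'M[R]_n := incidence *m susc_mx *m incidence^T.

Definition ptdf : 'M[R]_m :=
  susc_mx *m incidence^T *m mpinv laplacian *m incidence.

End Network.

(* The lines of a set [S] are listed by [enum_val : 'I_#|S| -> 'I_m]. *)
Definition subm (T : Type) m (S S' : {set 'I_m}) (M : 'M[T]_m) :
  'M[T]_(#|S|, #|S'|) :=
  \matrix_(i, j) M (enum_val i) (enum_val j).

Definition cols (T : Type) n m (S : {set 'I_m}) (M : 'M[T]_(n, m)) :
  'M[T]_(n, #|S|) :=
  \matrix_(i, j) M i (enum_val j).

Definition diagpart (R : realFieldType) p (M : 'M[R]_p) : 'M[R]_p :=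
  diag_mx (\row_i M i i).

Definition glodf (R : realFieldType) n m (G : network R n m)
    (X : {set 'I_m}) : 'M[R]_(#|~: X|, #|X|) :=
  subm (~: X) X (ptdf G) *m invmx (1%:M - subm X X (ptdf G)).

(* [f] lists the lines of [A] block by block: first those of the part [F 0],
   then those of [F 1], and so on; [tagnat.sig1 s] and [tagnat.sig2 s] are
   the block containing the position [s] and the position inside it. *)
Definition block_order m k (A : {set 'I_m}) (F : 'I_k -> {set 'I_m})
    (f : 'I_(\sum_j #|F j|)%N -> 'I_#|A|) : Prop :=
  bijective f /\
  forall s, enum_val (f s) = enum_val (tagnat.sig2 s) :> 'I_m.
Arguments block_order {m k} A F f.

(* Rectangular version of the library's [mxdiag]; [conform_mx] is only an
   identity cast here, as [i = j] in that branch. *)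
Definition blockdiag (R : realFieldType) k (p q : 'I_k -> nat)
    (K : forall j, 'M[R]_(p j, q j)) : 'M[R]_(\sum_j p j, \sum_j q j)%N :=
  \mxblock_(i, j) (if i == j then conform_mx 0 (K j) else 0).

(* Main.v *)
Require Import Defs.
From mathcomp Require Import all_boot all_order all_algebra.

Import Order.TTheory GRing.Theory Num.Theory.
Local Open Scope ring_scope.

(** Everything follows from three facts on the matrix [D = B C^T L^+ C].

    First, [D_ll' = 0] when [l] and [l'] lie in different blocks
    ([ptdf_same_block]). Since [L L^+ C = C], the vector [z = e_l' - D e_l'] is
    a circulation, and if [D_ll'] is nonzero for some [l] other than [l'], then
    [z] is nonzero on [l]. As a circulation has no net flow out of any set of
    vertices, [l] lies on a simple cycle directed along [z]
    ([circulation_cycle]). Outside [l'] the circulation is the flow of a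
    potential, which is strictly monotone along directed paths; so the cycle
    cannot avoid [l'], and [l], [l'] share a block.

    Second, lying in a common block is transitive ([same_block_trans]), by
    attaching to one cycle an ear of the other; thus the sets [E j] partition
    the lines, and the lines of [X] and of its complement can be listed block by
    block ([part_order]).

    Third, [1 - D_SS] is invertible whenever the removal of [S] leaves the graph
    connected, by an energy argument ([outage_unit]). This applies to [X], to
    its intersections with the blocks, and to its single lines.

    In the order by blocks both [1 - D_XX] and [D_{-X,X}] are block diagonal, so
    solving [K (1 - D_XX) = D_{-X,X}] block by block gives the blocks of the
    GLODF matrix ([glodf_block]). *)

(** * Sequences and matrices *)

Section Preliminaries.

Set Implicit Arguments.
Unset Strict Implicit.
Unset Printing Implicit Defensive.

(** A path of a symmetric relation from [x] to [y] with interior vertices [p]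
    can be walked backwards. *)
Lemma rev_path_sym (T : Type) (e : rel T) x p y :
  (forall u v, e u v = e v u) ->
  path e y (rcons (rev p) x) = path e x (rcons p y).
Proof.
move=> e_sym; have := rev_path e x (rcons p y).
rewrite last_rcons belast_rcons rev_cons => ->.
by apply: eq_path => u v; rewrite e_sym.
Qed.

(** A sequence with two distinct elements satisfying [P] splits at the first
    and at the last of its elements that satisfy [P]. *)
Lemma split_first_last (T : eqType) (P : pred T) (s : seq T) x y :
  x \in s -> y \in s -> P x -> P y -> x != y ->
  exists s1 a s' b s2, [/\ s = s1 ++ a :: s' ++ b :: s2,
    ~~ has P s1, ~~ has P s2, P a & P b].
Proof.
move=> sx sy Px Py neq_xy.
have /split_find : has P s by apply/hasP; exists x.
move: (take _ _) (drop _ _) => s1 s2 S.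
case: S sx sy => a {}s1 {}s2 Pa s1P; rewrite cat_rcons => sx sy.
have in2 z : z \in s1 ++ a :: s2 -> P z -> z != a -> z \in s2.
  rewrite mem_cat inE => /or3P[zs1 Pz|/eqP->|//]; last by rewrite eqxx.
  by case/hasP: s1P; exists z.
have : has P (rev s2).
  rewrite has_rev; apply/hasP.
  case: (eqVneq x a) => [xa|xa]; last by exists x => //; apply: in2.
  by exists y => //; apply: in2 => //; rewrite -xa eq_sym.
move=> /split_find; move: (take _ _) (drop _ _) => t1 t2 S.
move E : (rev s2) S => w S.
case: S E => b {}t1 {}t2 Pb t1P /(congr1 rev); rewrite revK => {sx sy in2}->.
exists s1, a, (rev t2), b, (rev t1); split => //; last by rewrite has_rev.
by rewrite rev_cat rev_rcons.
Qed.

Lemma sub_mxE (V : zmodType) p q (A B : 'M[V]_(p, q)) i j :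
  (A - B) i j = A i j - B i j.
Proof. by rewrite !mxE. Qed.

Lemma unitmx_ker0 (F : fieldType) p (A : 'M[F]_p) :
  (forall w : 'cV_p, A *m w = 0 -> w = 0) -> A \in unitmx.
Proof.
move=> ker0; rewrite -unitmx_tr -row_free_unit -kermx_eq0.
apply/eqP/row_matrixP => i; have := row_sub i (kermx A^T).
rewrite row0; set w := row i _ => /sub_kermxP /(congr1 trmx).
rewrite trmx_mul trmxK trmx0 => /ker0 /(congr1 trmx).
by rewrite trmxK trmx0.
Qed.

(** Listing the summation index of a matrix product through a bijection does
    not change the product. *)
Lemma mulmx_reindex (S : pzSemiRingType) p q r p' q' r'
    (f : 'I_p' -> 'I_p) (g : 'I_q' -> 'I_q) (h : 'I_r' -> 'I_r)
    (A : 'M[S]_(p, q)) (B : 'M[S]_(q, r)) :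
  bijective g -> mxsub f g A *m mxsub g h B = mxsub f h (A *m B).
Proof.
case=> gi gK giK; rewrite mxsub_mul; apply/matrixP => i j; rewrite !mxE.
by rewrite [RHS](reindex g); [apply: eq_bigr => s _; rewrite !mxE | exists gi].
Qed.

Lemma blockdiag_square (R : realFieldType) k (p : 'I_k -> nat)
    (K : forall j, 'M[R]_(p j)) :
  blockdiag K = \mxdiag_j K j.
Proof. by apply/eq_mxblockP => i j; case: eqP => // ->. Qed.

End Preliminaries.

(** * Transitivity of the block relation *)

Section CyclesAndBlocks.

Set Implicit Arguments.
Unset Strict Implicit.
Unset Printing Implicit Defensive.

Variables (R : realFieldType) (n m : nat) (G : network R n m).
Implicit Types (l : 'I_m) (u v : 'I_n) (c : seq 'I_n).

(** The pairs of vertices that are not the two ends of [l]: a cycle runs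
    through [l] iff it is not a cycle of this relation, which makes the theory
    of paths applicable to the lines of a cycle. *)
Definition avoids l : rel 'I_n := fun u v => ends G l != [set u; v].

Lemma avoids_sym l u v : avoids l u v = avoids l v u.
Proof. by rewrite /avoids setUC. Qed.

Lemma adj_sym (S : {set 'I_m}) u v : adj G S u v = adj G S v u.
Proof. by rewrite /adj setUC. Qed.

Lemma on_cycleE l c : uniq c -> on_cycle G l c = ~~ cycle (avoids l) c.
Proof.
move=> Uc; rewrite /on_cycle -[has _ _]negbK -all_predC; congr negb.
apply/allP/idP => [av|cyc v cv]; last exact: (next_cycle cyc cv).
by apply: cycle_from_next => // v /av.
Qed.

Lemma on_cycle_ends l c : on_cycle G l c -> src G l \in c /\ tgt G l \in c.
Proof.
case/hasP => v cv /eqP lE.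
have sub x : x \in ends G l -> x \in c.
  by rewrite lE !inE => /orP[] /eqP -> //; rewrite mem_next.
by split; apply: sub; rewrite /ends !inE eqxx ?orbT.
Qed.

Lemma ends_inj : injective (ends G).
Proof. exact: simple. Qed.

(** Two internally disjoint paths with the same ends close up to a simple
    cycle, so a line on one of them and a line on the other share a block.
    The paths run from [a] through [q] to [b] and from [b] through [r] to [a]. *)
Lemma ear_same_block l l' a b q r :
  path (adj G setT) a (rcons q b) -> path (adj G setT) b (rcons r a) ->
  uniq (a :: q ++ b :: r) ->
  ~~ path (avoids l) a (rcons q b) -> ~~ path (avoids l') b (rcons r a) ->
  same_block G l l'.
Proof.
move=> adjq adjr Uc lq l'r; apply/same_blockP.
have cycE e : cycle e (a :: q ++ b :: r)
    = path e a (rcons q b) && path e b (rcons r a).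
  by rewrite /= rcons_cat -cat_rcons cat_path last_rcons.
case: (eqVneq l l') => [->|neq_l]; [by left | right].
exists (a :: q ++ b :: r); split.
- rewrite /simple_cycle cycE adjq adjr Uc !andbT /= size_cat /=.
  (* Were both paths single lines, these lines would have the same ends. *)
  case: q r {adjq adjr Uc cycE} lq l'r => [|? ?] [|? ?] //=; rewrite ?addnS //.
  rewrite /avoids !andbT !negbK setUC => /eqP E1 /eqP E2.
  by rewrite (ends_inj (etrans E1 (esym E2))) eqxx in neq_l.
- by rewrite on_cycleE // cycE negb_and lq.
- by rewrite on_cycleE // cycE negb_and l'r orbT.
Qed.

Lemma same_block_sym l l' : same_block G l l' = same_block G l' l.
Proof.
by apply/same_blockP/same_blockP => -[->|[c [? ? ?]]]; try by [left];
  right; exists c.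
Qed.

(** If a cycle [c1] contains [l1] and [l2], and a cycle [c2] contains [l2] and
    [l3], then walking on [c2] from [l3] in both directions until [c1] is met
    gives an ear of [c1] with distinct ends. The ear, together with the arc of
    [c1] between its ends that contains [l1], is a cycle through [l1] and
    [l3]. *)
Lemma same_block_trans : transitive (same_block G).
Proof.
move=> l2 l1 l3 /same_blockP[->//|[c1 [sc1 l1c1 l2c1]]].
case/same_blockP => [<-|[c2 [sc2 l2c2 l3c2]]].
  by apply/same_blockP; right; exists c1.
have [/and3P[_ adj1 U1] /and3P[sz2 adj2 U2]] := (sc1, sc2).
have [s_c1 t_c1] := on_cycle_ends l2c1.
have [s_c2 t_c2] := on_cycle_ends l2c2.
(* Turn the second cycle so that the line l3 joins its last vertex to its
   first one. *)
have [v [x [p [i [rot2 l3vx]]]]] :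
    exists v x p i, rot i c2 = x :: rcons p v /\ ends G l3 = [set v; x].
  case/hasP: l3c2 => v c2v /eqP l3E; case: (rot_to c2v) => i p rotE.
  move: l3E; rewrite -(next_rot i) // rotE.
  case: p rotE => [|x p] rotE /=; first by move: sz2; rewrite -(size_rot i) rotE.
  rewrite eqxx => l3E; exists v, x, p.
  by exists (rot_add c2 i 1); rewrite -rot_rot_add rotE rot1_cons.
rewrite -(rot_cycle i) rot2 in adj2; rewrite -(rot_uniq i) rot2 in U2.
rewrite -(mem_rot i) rot2 in s_c2; rewrite -(mem_rot i) rot2 in t_c2.
(* The ear: the part of the second cycle through l3 that meets the first
   cycle in its two ends only. *)
have [s1 [a [s' [b [s2 [E s1c1 s2c1 c1a c1b]]]]]] :=
  split_first_last s_c2 t_c2 s_c1 t_c1 (loopless G l2).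
rewrite E in adj2 U2.
have ear_adj : path (adj G setT) b (rcons (s2 ++ s1) a).
  move: adj2; have -> : s1 ++ a :: s' ++ b :: s2 = (s1 ++ a :: s') ++ b :: s2.
    by rewrite -catA.
  rewrite cycle_catC /= catA rcons_cat /= -cat_rcons cat_path.
  by case/andP.
have ear_l3 : ~~ path (avoids l3) b (rcons (s2 ++ s1) a).
  rewrite rcons_cat cat_path negb_and; apply/orP; right.
  have -> : last b s2 = v.
    have := congr1 (last x) E; rewrite /= last_rcons => ->.
    by rewrite last_cat /= last_cat.
  by case: (s1) E => [|? ?] [<- _] /=; rewrite /avoids l3vx eqxx.
have ab : a != b.
  by apply: contraTneq U2 => ->; rewrite cat_uniq /= mem_cat mem_head orbT !andbF.
have c1P x1 t : ~~ has [in c1] t -> x1 \in c1 -> x1 \notin t.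
  by move=> tc1 c1x1; apply: contra tc1 => tx1; apply/hasP; exists x1.
have ear_uniq q : uniq (a :: rcons q b) -> {subset q <= c1} ->
    uniq (a :: q ++ b :: s2 ++ s1).
  move=> Uq qc1.
  have -> : a :: q ++ b :: s2 ++ s1 = (a :: rcons q b) ++ (s2 ++ s1).
    by rewrite -cat_rcons.
  rewrite cat_uniq Uq /=; apply/andP; split.
    apply/hasPn => z zs; apply/negP => zq; have c1z : z \in c1.
      by move: zq; rewrite inE mem_rcons inE => /or3P[/eqP->|/eqP->|/qc1].
    move: zs; rewrite mem_cat.
    by rewrite (negPf (c1P _ _ s1c1 c1z)) (negPf (c1P _ _ s2c1 c1z)).
  have P : perm_eq (s1 ++ a :: s' ++ b :: s2) ((s2 ++ s1) ++ (a :: rcons s' b)).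
    have -> : s1 ++ a :: s' ++ b :: s2 = (s1 ++ a :: rcons s' b) ++ s2.
      by rewrite -catA cat_cons cat_rcons.
    by rewrite perm_catC -catA.
  by move: U2; rewrite (perm_uniq P) cat_uniq => /andP[].
(* The ends of the ear cut the first cycle into two arcs; the second arc is
   reversed so that it too leads from a to b. *)
case: (rot_to_arc U1 c1a c1b ab) => j q1 q2 _ _ rot1.
rewrite -(rot_cycle j) rot1 in adj1; rewrite -(rot_uniq j) rot1 in U1.
move: l1c1; rewrite on_cycleE; last by case/and3P: sc1.
rewrite -(rot_cycle j) rot1 /= rcons_cat -cat_rcons cat_path last_rcons.
rewrite negb_and.
move: adj1; rewrite /= rcons_cat -cat_rcons cat_path last_rcons.
move=> /andP[adjq1 adjq2].
have c1sub z : z \in a :: q1 ++ b :: q2 -> z \in c1 by rewrite -rot1 mem_rot.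
case/orP => l1q.
  apply: ear_same_block adjq1 ear_adj _ l1q ear_l3; apply: ear_uniq.
    by move: U1; rewrite -cat_rcons -cat_cons cat_uniq => /andP[].
  by move=> z qz; apply: c1sub; rewrite !(inE, mem_cat) qz orbT.
rewrite -rev_path_sym in adjq2; last exact: adj_sym.
rewrite -rev_path_sym in l1q; last exact: avoids_sym.
apply: ear_same_block adjq2 ear_adj _ l1q ear_l3; apply: ear_uniq.
  rewrite -rev_cons -rev_rcons rev_uniq.
  by move: U1; rewrite rcons_uniq cons_uniq mem_cat negb_or cat_uniq
    => /andP[/andP[_ ->] /and3P[]].
by move=> z; rewrite mem_rev => qz; apply: c1sub; rewrite !(inE, mem_cat) qz !orbT.
Qed.

End CyclesAndBlocks.

(** * Circulations and the PTDF matrix *)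

Section Flows.

Set Implicit Arguments.
Unset Strict Implicit.
Unset Printing Implicit Defensive.

Variables (R : realFieldType) (n m : nat) (G : network R n m).
Implicit Types (l : 'I_m) (u v : 'I_n) (z : 'cV[R]_m).

Local Notation C := (incidence G).
Local Notation Lp := (mpinv (laplacian G)).
Local Notation D := (ptdf G).

Lemma mul_incidence p (A : 'M[R]_(p, n)) i l :
  (A *m C) i l = A i (src G l) - A i (tgt G l).
Proof.
rewrite mxE (bigD1 (src G l)) //= (bigD1 (tgt G l)) /=; last first.
  by rewrite eq_sym loopless.
rewrite !mxE eqxx eq_sym (negPf (loopless G l)) eqxx mulr1 mulrN1 big1 ?addr0 //.
by move=> u /andP[/negPf us /negPf ut]; rewrite mxE us ut mulr0.
Qed.

Lemma incidence_tr_mul p (A : 'M[R]_(n, p)) l j :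
  (C^T *m A) l j = A (src G l) j - A (tgt G l) j.
Proof.
by have := mul_incidence A^T j l; rewrite -[in LHS](trmxK C) -trmx_mul !mxE.
Qed.

Lemma susc_mx_mul p (A : 'M[R]_(m, p)) l j :
  (susc_mx G *m A) l j = susc G l * A l j.
Proof. by rewrite /susc_mx mul_diag_mx !mxE. Qed.

(** [L L^+] fixes the columns of [C]: with [Q := 1 - L L^+], [Q L = 0] gives
    [(Q C) B (Q C)^T = 0], whose diagonal entries are sums of squares of the
    entries of [Q C] with the positive weights [b_l]. *)
Lemma laplacian_mpinv_incidence : laplacian G *m Lp *m C = C.
Proof.
set L := laplacian G; have /and4P[/eqP LXL _ _ _] := mpinvP L.
pose Q := 1%:M - L *m mpinv L.
suff QC : Q *m C = 0.
  by apply/eqP; rewrite eq_sym -subr_eq0 -{1}(mul1mx C) -mulmxBl QC.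
have QL : Q *m L = 0 by rewrite mulmxBl mul1mx LXL subrr.
have QBQ : (Q *m C) *m susc_mx G *m (Q *m C)^T = 0.
  by rewrite trmx_mul !mulmxA -(mulmxA Q) -(mulmxA Q) -/(laplacian G) QL mul0mx.
apply/matrixP => i l; transitivity (0 : R); last by rewrite mxE.
have : \sum_l1 (Q *m C) i l1 * (susc_mx G *m (Q *m C)^T) l1 i = 0.
  have := congr1 (fun M : 'M_n => M i i) QBQ.
  by rewrite -mulmxA mxE [_ _ _ in RHS]mxE.
move=> /eqP.
have sqE l1 : (Q *m C) i l1 * (susc_mx G *m (Q *m C)^T) l1 i
    = susc G l1 * ((Q *m C) i l1) ^+ 2.
  by rewrite susc_mx_mul [_^T _ _]mxE mulrCA expr2.
rewrite (eq_bigr _ (fun l1 _ => sqE l1)) psumr_eq0; last first.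
  by move=> l1 _; rewrite mulr_ge0 ?sqr_ge0 // ltW ?susc_gt0.
move=> /allP /(_ l); rewrite mem_index_enum /= => /(_ isT).
by rewrite mulf_eq0 sqrf_eq0 gt_eqF ?susc_gt0 //= => /eqP.
Qed.

(** The line flow [D e_l] routes the same injections as the unit flow on [l];
    hence [A - D A] consists of circulations, for every [A]. *)
Lemma incidence_ptdf : C *m D = C.
Proof. by rewrite /ptdf !mulmxA laplacian_mpinv_incidence. Qed.

(** Ohm's law: [D A] is a flow driven by the potential [L^+ C A]. *)
Lemma ptdfE p (A : 'M[R]_(m, p)) l j : (D *m A) l j =
  susc G l * ((Lp *m C *m A) (src G l) j - (Lp *m C *m A) (tgt G l) j).
Proof. by rewrite /ptdf -!mulmxA susc_mx_mul incidence_tr_mul !mulmxA. Qed.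

(** A circulation is orthogonal to every potential difference. *)
Lemma kirchhoff z (phi : 'I_n -> R) : C *m z = 0 ->
  \sum_l (phi (src G l) - phi (tgt G l)) * z l 0 = 0.
Proof.
move=> Cz; pose r := \row_i phi i.
transitivity ((r *m C *m z) 0 0); last by rewrite -mulmxA Cz mulmx0 mxE.
rewrite [RHS]mxE; apply: eq_bigr => l _.
by rewrite mul_incidence ![r _ _]mxE.
Qed.

(** The circulation [z] carries a positive flow from [u] to [v] along a line. *)
Definition forward z : rel 'I_n := fun u v => [exists l,
  [&& src G l == u, tgt G l == v & 0 < z l 0]
  || [&& tgt G l == u, src G l == v & z l 0 < 0]].

(** The vertices reachable from [u] along the flow form a set that the flow
    does not leave; since the net flow of a circulation out of any set is zero,
    it does not enter this set either. *)
Lemma connect_forward_ends z u l : C *m z = 0 -> z l 0 != 0 ->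
  connect (forward z) u (src G l) = connect (forward z) u (tgt G l).
Proof.
move=> Cz zl; pose W : pred 'I_n := connect (forward z) u.
rewrite -/(W _) -/(W _); pose phi v : R := (W v)%:R.
have step v w : forward z v w -> W v -> W w.
  by move=> vw Wv; apply: connect_trans Wv (connect1 vw).
have le0 l1 : (phi (src G l1) - phi (tgt G l1)) * z l1 0 <= 0.
  rewrite /phi; case Ws: (W _); case Wt: (W _);
    rewrite ?subrr ?mul0r // ?subr0 ?mul1r ?sub0r ?mulN1r ?oppr_le0 leNgt;
    apply/negP => z1.
    suff: W (tgt G l1) by rewrite Wt.
    by apply: step Ws; apply/existsP; exists l1; rewrite !eqxx z1.
  suff: W (src G l1) by rewrite Ws.
  by apply: step Wt; apply/existsP; exists l1; rewrite !eqxx z1 orbT.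
have := kirchhoff phi Cz => /eqP; rewrite -oppr_eq0 -sumrN psumr_eq0; last first.
  by move=> l1 _; rewrite oppr_ge0.
move=> /allP /(_ l); rewrite mem_index_enum /= => /(_ isT).
rewrite oppr_eq0 mulf_eq0 (negPf zl) orbF /phi.
by case: (W _); case: (W _); rewrite ?subr0 ?sub0r ?oppr_eq0 ?oner_eq0.
Qed.

Lemma forward_line z u v : forward z u v ->
  exists2 l, ends G l = [set u; v] & z l 0 != 0.
Proof.
by case/existsP => l /orP[] /and3P[/eqP <- /eqP <- zl]; exists l;
  rewrite ?(gt_eqF zl) ?(lt_eqF zl) // /ends setUC.
Qed.

Lemma forward_asym z u v : forward z u v -> ~~ forward z v u.
Proof.
move=> /existsP[l Hl]; apply/negP => /existsP[l' Hl'].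
have E : l' = l.
  apply: (@simple _ _ _ G); rewrite -/(ends G l) -/(ends G l').
  by case/orP: Hl => /and3P[/eqP ? /eqP ? _];
   case/orP: Hl' => /and3P[/eqP ? /eqP ? _];
   subst u v; rewrite /ends; do ?[congruence | rewrite setUC].
move: Hl Hl'; rewrite E.
have neq := loopless G l.
case/orP => /and3P[/eqP <- /eqP <- zl]; rewrite !eqxx (negPf neq) eq_sym
  (negPf neq) /=; by [rewrite ltNge ltW | rewrite orbF ltNge ltW].
Qed.

(** Every line of the support of a circulation lies on a simple cycle that
    follows the direction of the flow. *)
Lemma circulation_cycle z l : C *m z = 0 -> z l 0 != 0 ->
  exists c, [/\ simple_cycle G c, on_cycle G l c & cycle (forward z) c].
Proof.
move=> Cz zl.
have [u [w [lE uw]]] : exists u w, ends G l = [set u; w] /\ forward z u w.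
  case: (ltgtP (z l 0) 0) zl => // zl _.
    exists (tgt G l), (src G l); split; first by rewrite /ends setUC.
    by apply/existsP; exists l; rewrite !eqxx zl orbT.
  exists (src G l), (tgt G l); split=> //.
  by apply/existsP; exists l; rewrite !eqxx zl.
(* The flow passes l from u to w; it can be followed back from w to u. *)
have /connectP[p0 fwd0 u0] : connect (forward z) w u.
  have reach x : x \in ends G l ->
      connect (forward z) w x = connect (forward z) w (src G l).
    by rewrite !inE => /orP[] /eqP ->; rewrite // -connect_forward_ends.
  by rewrite reach ?lE ?inE ?eqxx // -(reach w) ?lE ?inE ?eqxx ?orbT ?connect0.
case/shortenP: fwd0 u0 => p fwd Up _ uE.
have cyc : cycle (forward z) (w :: p) by rewrite /= rcons_path fwd -uE.
exists (w :: p); split=> //; last first.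
  by rewrite on_cycleE // /= rcons_path -uE /avoids lE eqxx andbF.
apply/and3P; split=> //.
  (* A return path of length one would carry flow from w to u on the line l
     itself. *)
  case: p {cyc Up} fwd uE => [|x [|y p]] //=.
    by move=> _ uw'; move: (forward_asym uw); rewrite uw' in uw *; rewrite uw.
  rewrite andbT => fwx ux; rewrite -ux in fwx.
  by move: (forward_asym uw); rewrite fwx.
apply: sub_cycle cyc => x y /forward_line[l1 E _].
by apply/existsP; exists l1; rewrite inE E eqxx.
Qed.

(** A line [l] on which a unit transfer across [l'] induces a flow shares a
    block with [l']: if [l] is not [l'], the circulation [e_l' - D e_l'] has a
    directed cycle through [l], and if this cycle avoided [l'], the flow along
    it would be driven by a potential that increases strictly around the
    cycle. *)
Lemma ptdf_same_block l l' : D l l' != 0 -> same_block G l l'.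
Proof.
move=> Dl; apply/same_blockP; case: (eqVneq l l') => [|neq]; [by left | right].
pose e : 'cV[R]_m := delta_mx l' 0; pose z := e - D *m e.
have zE l1 : l1 != l' -> z l1 0 = - D l1 l'.
  by move=> /negPf ne; rewrite /z /e -colE !mxE ne sub0r.
have Cz : C *m z = 0 by rewrite mulmxBr (mulmxA C D) incidence_ptdf subrr.
have zl : z l 0 != 0 by rewrite zE // oppr_eq0.
have [c [sc lc fwd_c]] := circulation_cycle Cz zl.
exists c; split=> //; have /and3P[sz _ Uc] := sc.
rewrite on_cycleE //; apply/negP => avoid_c.
pose v := Lp *m C *m e.
have up x y : forward z x y -> avoids G l' x y -> v x 0 < v y 0.
  have zlE l1 : l1 != l' ->
      z l1 0 = susc G l1 * (v (tgt G l1) 0 - v (src G l1) 0).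
    move=> ne; rewrite sub_mxE ptdfE -/v.
    by rewrite mxE (negPf ne) sub0r -mulrN opprB.
  case/existsP => l1 ends_z1 av_xy.
  have /zlE z1E : l1 != l'.
    apply: contraNneq av_xy => <-.
    by case/orP: ends_z1 => /and3P[/eqP <- /eqP <- _]; rewrite /ends // setUC.
  move: ends_z1; rewrite z1E pmulr_rgt0 ?pmulr_rlt0 ?susc_gt0 // subr_gt0 subr_lt0.
  by case/orP => /and3P[/eqP <- /eqP <-].
have : cycle (fun x y => v x 0 < v y 0) c.
  case: (c) fwd_c avoid_c => //= x0 p; elim: (rcons p x0) {1 3 5}x0 => //= y q IH x.
  by case/andP => xy /IH{}IH /andP[/(up _ _ xy) -> /IH].
rewrite cycle_all2rel; last by move=> y x w; apply: lt_trans.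
by case: (c) sz => // x p _ /allrelP /(_ x x); rewrite mem_head ltxx => /(_ isT isT).
Qed.

(** If the lines outside the range of [h] connect the graph, then [1 - D_hh]
    is injective: for [w] in its kernel, extended by zero to [e], the
    circulation [z = e - D e] vanishes on the range of [h] and is minus the
    flow of the potential [v] elsewhere. By orthogonality to [v] that flow
    dissipates no energy, so [v] is constant, [D e = 0], and [w = 0]. *)
Lemma outage_unit p (h : 'I_p -> 'I_m) : injective h ->
  connected G [set l | l \notin codom h] ->
  1%:M - mxsub h h D \in unitmx.
Proof.
move=> h_inj conn; apply: unitmx_ker0 => w Dw.
pose e : 'cV[R]_m := colsub h 1%:M *m w; pose z := e - D *m e.
have e_in k : e (h k) 0 = w k 0.
  rewrite mxE (bigD1 k) //= !mxE eqxx mul1r big1 ?addr0 // => k' nk.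
  by rewrite !mxE (inj_eq h_inj) eq_sym (negPf nk) mul0r.
have e_out l : l \notin codom h -> e l 0 = 0.
  move=> hl; rewrite mxE big1 // => k _; rewrite !mxE.
  by case: eqP hl => [->|]; rewrite ?codom_f ?mul0r.
have z_in k : z (h k) 0 = 0.
  have := congr1 (fun M : 'cV_p => M k 0) Dw; rewrite mulmxBl mul1mx [in RHS]mxE => <-.
  rewrite !sub_mxE e_in; congr (_ - _).
  rewrite /e mulmxA -[colsub h 1%:M]/(mxsub id h 1%:M).
  rewrite mulmx_colsub mulmx1 !mxE; by apply: eq_bigr => k' _; rewrite !mxE.
have Cz : C *m z = 0 by rewrite mulmxBr (mulmxA C D) incidence_ptdf subrr.
pose v := Lp *m C *m e.
have z_out l : l \notin codom h ->
    z l 0 = susc G l * (v (tgt G l) 0 - v (src G l) 0).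
  by move=> hl; rewrite sub_mxE e_out // ptdfE -/v sub0r -mulrN opprB.
have v_out l : l \notin codom h -> v (src G l) 0 = v (tgt G l) 0.
  move=> hl; have /eqP := kirchhoff (fun u => v u 0) Cz.
  rewrite -oppr_eq0 -sumrN psumr_eq0 => [/allP /(_ l)|l1 _].
    rewrite mem_index_enum => /(_ isT); rewrite z_out // oppr_eq0 !mulf_eq0.
    rewrite (gt_eqF (susc_gt0 G l)) /= !subr_eq0 [X in _ || X]eq_sym orbb.
    by move/eqP.
  have [/codomP[k ->]|hl1] := boolP (l1 \in codom h).
    by rewrite z_in mulr0 oppr0.
  rewrite z_out // mulrCA -mulrN -mulrN opprB -expr2.
  by rewrite mulr_ge0 ?sqr_ge0 // ltW ?susc_gt0.
have v_const x y : v x 0 = v y 0.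
  have /forallP/(_ x)/forallP/(_ y)/connectP[q adj_q ->] := conn.
  elim: q x adj_q => //= x' q IH x /andP[/existsP[l]].
  rewrite inE => /andP[hl /eqP lE] /IH <-.
  have [xE yE] : x \in ends G l /\ x' \in ends G l by rewrite lE !inE !eqxx orbT.
  by move: xE yE; rewrite !inE => /orP[] /eqP -> /orP[] /eqP ->; rewrite ?v_out.
apply/colP => k; rewrite -e_in [RHS]mxE; have := z_in k.
by rewrite sub_mxE ptdfE -/v (v_const _ (tgt G (h k))) subrr mulr0 subr0.
Qed.

End Flows.

(** * The GLODF matrix in block order *)

Section BlockForm.

Set Implicit Arguments.
Unset Strict Implicit.
Unset Printing Implicit Defensive.

(** A partition of [A] lets the lines of [A] be listed part by part. *)
Lemma block_order_exists m k (A : {set 'I_m}) (F : 'I_k -> {set 'I_m}) :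
  A = \bigcup_j F j ->
  (forall i j l, l \in F i -> l \in F j -> i = j) ->
  exists f, block_order A F f.
Proof.
move=> AE disj.
pose line (s : 'I_(\sum_j #|F j|)%N) : 'I_m := enum_val (tagnat.sig2 s).
have lineF s : line s \in F (tagnat.sig1 s) by apply: enum_valP.
have lineA s : line s \in A by rewrite AE; apply/bigcupP; exists (tagnat.sig1 s).
pose f s : 'I_#|A| := enum_rank_in (lineA s) (line s).
have fE s : enum_val (f s) = line s by apply: enum_rankK_in.
have line_inj : injective line.
  move=> s t eq_st; apply: tagnat.sig_inj; rewrite !tagnat.sigE12.
  have := disj _ _ _ (lineF s); rewrite eq_st => /(_ _ (lineF t)).
  move: eq_st; rewrite /line; move: (tagnat.sig2 s) (tagnat.sig2 t).
  move: (tagnat.sig1 s) (tagnat.sig1 t) => i j x y eq_xy eq_ij.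
  by case: _ / eq_ij y eq_xy => y /enum_val_inj ->.
have f_inj : injective f by move=> s t eq_st; apply: line_inj; rewrite -!fE eq_st.
exists f; split=> //.
apply: inj_card_bij f_inj _; rewrite !card_ord AE -sum1_card.
under [X in (_ <= X)%N]eq_bigr do rewrite -sum1_card.
rewrite (exchange_big_dep predT) //= [X in (_ <= X)%N](bigID [in \bigcup_j F j]) /=.
apply: leq_trans (leq_addr _ _); apply: leq_sum => l /bigcupP[j _ lj].
by rewrite (bigD1 j).
Qed.

Variables (R : realFieldType) (n m : nat) (G : network R n m).

(** The products of submatrices that define [D_j] and [D_{-j}] are submatrices
    of [D], because [B] is diagonal. *)
Lemma subm_ptdf (S T : {set 'I_m}) :
  subm S S (susc_mx G) *m (cols S (incidence G))^T *m mpinv (laplacian G)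
    *m cols T (incidence G) = subm S T (ptdf G).
Proof.
have -> : cols T (incidence G) = colsub enum_val (incidence G) by [].
have -> : (cols S (incidence G))^T = rowsub enum_val (incidence G)^T.
  by apply/matrixP => i j; rewrite !mxE.
have -> : subm S S (susc_mx G) = diag_mx (\row_i susc G (enum_val i)).
  by apply/matrixP => i j; rewrite !mxE (inj_eq enum_val_inj).
rewrite mul_diag_mx -[RHS]/(mxsub enum_val enum_val (ptdf G)) mxsub_mul.
congr (_ *m _); rewrite -mul_rowsub_mx; congr (_ *m _).
by apply/matrixP => i j; rewrite [RHS]mxE susc_mx_mul !mxE.
Qed.

Lemma connected_sub (S T : {set 'I_m}) :
  S \subset T -> connected G S -> connected G T.
Proof.
move=> ST /forallP conn; apply/forallP => u; apply/forallP => v.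
have /forallP/(_ v) := conn u; apply: connect_sub => x y /existsP[l].
move=> /andP[Sl lE]; apply: connect1; apply/existsP; exists l.
by rewrite (subsetP ST).
Qed.

Lemma subm_outage_unit (S X : {set 'I_m}) : S \subset X ->
  connected G (~: X) -> 1%:M - subm S S (ptdf G) \in unitmx.
Proof.
move=> SX conn; apply: (outage_unit enum_val_inj); apply: connected_sub conn.
apply/subsetP => l; rewrite !inE; apply: contra => /codomP[i ->].
by rewrite (subsetP SX) ?enum_valP.
Qed.

(** The outage of any single line of [S] alone leaves the graph connected, so
    each diagonal entry [1 - D_ll] is nonzero. *)
Lemma diag_outage_unit (S X : {set 'I_m}) : S \subset X ->
  connected G (~: X) -> 1%:M - diagpart (subm S S (ptdf G)) \in unitmx.
Proof.
move=> SX conn.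
have -> : 1%:M - diagpart (subm S S (ptdf G))
    = diag_mx (\row_i (1 - ptdf G (enum_val i) (enum_val i))).
  by apply/matrixP => i j; rewrite !mxE; case: eqP; rewrite ?subrr.
rewrite unitmxE det_diag unitfE prodf_seq_neq0; apply/allP => i _ /=.
pose h (_ : 'I_1) : 'I_m := enum_val i.
have h_inj : injective h by move=> a b _; rewrite !ord1.
have := @outage_unit _ _ _ G _ _ h_inj; rewrite unitmxE unitfE det_mx11 !mxE; apply.
apply: connected_sub conn.
apply/subsetP => l; rewrite !inE; apply: contra => /codomP[j ->].
by rewrite (subsetP SX) ?enum_valP.
Qed.

Section Partition.

Variables (k : nat) (E : 'I_k -> {set 'I_m}).
Hypotheses (E_inj : injective E) (E_blocks : [set E j | j : 'I_k] = blocks G).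

Lemma same_block_part j l l' :
  l \in E j -> (l' \in E j) = same_block G l l'.
Proof.
have: E j \in blocks G by rewrite -E_blocks imset_f.
case/imsetP => l0 _ ->; rewrite !inE => l0l.
apply/idP/idP; last exact: same_block_trans.
by apply: same_block_trans; rewrite same_block_sym.
Qed.

Lemma part_cover l : exists j, l \in E j.
Proof.
have : [set l' in [set: 'I_m] | same_block G l l'] \in blocks G.
  by apply: imset_f; rewrite inE.
rewrite -E_blocks => /imsetP[j _ jE]; exists j; rewrite -jE !inE.
by rewrite /same_block eqxx.
Qed.

Lemma part_disjoint i j l : l \in E i -> l \in E j -> i = j.
Proof.
move=> li lj; apply: E_inj; apply/setP => l'.
by rewrite (same_block_part _ li) (same_block_part _ lj).
Qed.

Lemma part_order (A : {set 'I_m}) (F : 'I_k -> {set 'I_m}) :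
  (forall j l, (l \in F j) = (l \in A) && (l \in E j)) ->
  exists f, block_order A F f.
Proof.
move=> FE; apply: block_order_exists => [|i j l]; last first.
  by rewrite !FE => /andP[_ li] /andP[_]; apply: part_disjoint.
apply/setP => l; apply/idP/bigcupP => [Al|[j _]]; last by rewrite FE => /andP[].
by have [j lj] := part_cover l; exists j; rewrite ?FE ?Al.
Qed.

Lemma ptdf_part i j l l' :
  l \in E i -> l' \in E j -> i != j -> ptdf G l l' = 0.
Proof.
move=> li lj; apply: contraNeq => /ptdf_same_block.
by rewrite -(same_block_part _ li) => l'i; apply/eqP; apply: part_disjoint lj.
Qed.

(** [D] vanishes between different blocks, so its submatrices are block
    diagonal when rows and columns are listed by blocks. *)
Lemma mxsub_block (A A' : {set 'I_m}) (F F' : 'I_k -> {set 'I_m}) f f' :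
  (forall j, F j \subset E j) -> (forall j, F' j \subset E j) ->
  block_order A F f -> block_order A' F' f' ->
  mxsub f f' (subm A A' (ptdf G)) = blockdiag (fun j => subm (F j) (F' j) (ptdf G)).
Proof.
move=> FE F'E [_ fE] [_ f'E]; move: (ptdf G) ptdf_part => D D0.
apply/matrixP => s t; rewrite !mxE fE f'E.
have := subsetP (FE _) _ (enum_valP (tagnat.sig2 s)).
have := subsetP (F'E _) _ (enum_valP (tagnat.sig2 t)).
move: (tagnat.sig2 s) (tagnat.sig2 t); move: (tagnat.sig1 s) (tagnat.sig1 t).
move=> i j x y yE xE; case: eqVneq => [ij|ij]; last by rewrite mxE (D0 _ _ _ _ xE yE).
by case: _ / ij y yE => y _; rewrite conform_mx_id mxE.
Qed.

(** After the reordering, [K^X (1 - D_XX) = D_{-X,X}] is an equation between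
    [K^X] and two block diagonal matrices; as [1 - D_XX] is invertible, it
    determines [K^X]. *)
Lemma glodf_block (X : {set 'I_m}) f g :
  connected G (~: X) ->
  block_order (~: X) (fun j => E j :\: X) f ->
  block_order X (fun j => X :&: E j) g ->
  mxsub f g (glodf G X) = blockdiag (fun j =>
    subm (E j :\: X) (X :&: E j) (ptdf G)
      *m invmx (1%:M - subm (X :&: E j) (X :&: E j) (ptdf G))).
Proof.
move=> conn f_ord g_ord; have [g_bij gE] := g_ord.
set M := 1%:M - subm X X (ptdf G).
have uM : M \in unitmx by apply: subm_outage_unit conn.
have uMg : mxsub g g M \in unitmx.
  suff : mxsub g g M *m mxsub g g (invmx M) = 1%:M by case/mulmx1_unit.
  rewrite mulmx_reindex // mulmxV //; apply/matrixP => s t; rewrite !mxE.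
  by rewrite (inj_eq (bij_inj g_bij)).
apply: (can_inj (mulmxK uMg)); rewrite mulmx_reindex // mulmxKV //.
have MgE : mxsub g g M
    = \mxdiag_j (1%:M - subm (X :&: E j) (X :&: E j) (ptdf G)).
  rewrite mxdiagB mxdiagZ -blockdiag_square.
  rewrite -(mxsub_block _ _ g_ord g_ord) => [|j|j]; try exact: subsetIr.
  apply/matrixP => s t.
  by rewrite [LHS]mxE !sub_mxE !mxE (inj_eq (bij_inj g_bij)).
rewrite MgE /blockdiag mul_mxblock_mxdiag.
rewrite (mxsub_block _ _ f_ord g_ord) => [|j|j]; [|exact: subsetDl|exact: subsetIr].
apply/eq_mxblockP => i j; case: eqVneq => [ij|_]; last by rewrite mul0mx.
case: _ / ij; rewrite !conform_mx_id mulmxKV //.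
by apply: subm_outage_unit conn; apply: subsetIl.
Qed.

End Partition.

End BlockForm.

Theorem proposition4p4 (R : realFieldType) (n m : nat) (G : network R n m)
    (X : {set 'I_m}) (k : nat) (E : 'I_k -> {set 'I_m})
    (connG : connected G [set: 'I_m])
    (properX : X \proper [set: 'I_m])
    (noncutX : connected G (~: X))
    (E_inj : injective E)
    (E_blocks : [set E j | j : 'I_k] = blocks G) :
  let B := susc_mx G in
  let C := incidence G in
  let Ld := mpinv (laplacian G) in
  let Xj (j : 'I_k) := X :&: E j in
  let Xmj (j : 'I_k) := E j :\: X in
  let Dj (j : 'I_k) : 'M[R]_#|Xj j| :=
    subm (Xj j) (Xj j) B *m (cols (Xj j) C)^T *m Ld *m cols (Xj j) C in
  let Dmj (j : 'I_k) : 'M[R]_(#|Xmj j|, #|Xj j|) :=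
    subm (Xmj j) (Xmj j) B *m (cols (Xmj j) C)^T *m Ld *m cols (Xj j) C in
  let Kj (j : 'I_k) : 'M[R]_(#|Xmj j|, #|Xj j|) :=
    Dmj j *m invmx (1%:M - diagpart (Dj j)) in
  let KXj (j : 'I_k) : 'M[R]_(#|Xmj j|, #|Xj j|) :=
    subm (Xmj j) (Xmj j) B *m (cols (Xmj j) C)^T *m Ld *m cols (Xj j) C
    *m invmx (1%:M - subm (Xj j) (Xj j) B *m (cols (Xj j) C)^T *m Ld
                     *m cols (Xj j) C) in
  [/\ (* every inverse occurring in the statement is a genuine one *)
      [/\ 1%:M - subm X X (ptdf G) \in unitmx,
          forall j, 1%:M - Dj j \in unitmx
        & forall j, 1%:M - diagpart (Dj j) \in unitmx],
      exists (f : 'I_(\sum_j #|Xmj j|)%N -> 'I_#|~: X|)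
             (g : 'I_(\sum_j #|Xj j|)%N -> 'I_#|X|),
        [/\ block_order (~: X) Xmj f, block_order X Xj g
          & mxsub f g (glodf G X) = blockdiag KXj],
      forall j,
        KXj j = Dmj j *m invmx (1%:M - Dj j) /\
        KXj j = Kj j *m (1%:M - diagpart (Dj j)) *m invmx (1%:M - Dj j)
    & forall (l lhat : 'I_m) (hl : l \in ~: X) (hlhat : lhat \in X),
        (forall j, ~~ ((l \in E j) && (lhat \in E j))) ->
        glodf G X (enum_rank_in hl l) (enum_rank_in hlhat lhat) = 0].
Proof.
move=> B C Ld Xj Xmj Dj Dmj Kj KXj.
have DjE j : Dj j = subm (Xj j) (Xj j) (ptdf G) by apply: subm_ptdf.
have DmjE j : Dmj j = subm (Xmj j) (Xj j) (ptdf G) by apply: subm_ptdf.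
have XjX j : Xj j \subset X by apply: subsetIl.
have [f f_ord] : exists f, block_order (~: X) Xmj f.
  by apply: (part_order E_inj E_blocks) => j l; rewrite !inE.
have [g g_ord] : exists g, block_order X Xj g.
  by apply: (part_order E_inj E_blocks) => j l; rewrite !inE.
have KE : mxsub f g (glodf G X) = blockdiag KXj.
  rewrite (glodf_block E_inj E_blocks noncutX f_ord g_ord).
  apply/eq_mxblockP => i j; case: eqP => // _; congr conform_mx.
  by rewrite -DjE -DmjE.
split.
- split=> [|j|j]; first exact: subm_outage_unit noncutX.
    by rewrite DjE; apply: subm_outage_unit noncutX.
  by rewrite DjE; apply: diag_outage_unit noncutX.
- by exists f, g.
- move=> j; split=> //; rewrite /Kj mulmxKV // DjE.
  exact: diag_outage_unit noncutX.
move=> l lhat hl hlhat sep.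
have [[[fi _ fiK] fE] [[gi _ giK] gE]] := (f_ord, g_ord).
(* The entry is read off the block form at the positions of l and lhat. *)
set i := enum_rank_in hl l; set j := enum_rank_in hlhat lhat.
have := congr1 (fun M : 'M_(_, _) => M (fi i) (gi j)) KE.
rewrite [LHS]mxE fiK giK => ->; rewrite mxE.
have := enum_valP (tagnat.sig2 (fi i)); have := enum_valP (tagnat.sig2 (gi j)).
rewrite -fE -gE fiK giK !enum_rankK_in // !inE.
move: (tagnat.sig2 _) (tagnat.sig2 _) => x y /andP[_ lhatE] /andP[_ lE].
case: eqP => [ij|_]; last by rewrite mxE.
by case/negP: (sep (tagnat.sig1 (gi j))); rewrite lhatE -ij lE.
Qed.
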